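(* Let $(X,\mathcal B,\mu,T)$ be a probability-preserving ergodic system with a filtration $\{\mathcal B_n\}_{n\in\mathbb N}$ that is $\psi$-mixing (as defined in the context). If $\{A_n\}_{n\ge1}$ is a sequence of sets with $A_n\in\mathcal A_{1/n}$ for every $n$, then $$\lim_{n\to\infty}\frac{\rho_{A_n}}{\mu(A_n)}=1 .$$
   Context: $\mathbb N=\{1,2,\dots\}$. $(X,\mathcal B,\mu)$ is a probability space, $T:X\to X$ is measure-preserving and ergodic, and $\{\mathcal B_n\}_{n\in\mathbb N}$ is an increasing sequence of sub-$\sigma$-algebras of $\mathcal B$ (a filtration of $\mathcal B$) with $T^{-1}\mathcal B_n\subset\mathcal B_{n+1}$ for every $n$. $\psi$-mixing: there exists $\psi:\mathbb N\to\mathbb R_+$ (write $\psi_k=\psi(k)$) such that (1) $\psi_n\to0$ as $n\to\infty$; (2) for all $n,m,k\in\mathbb N$, $A\in\mathcal B_n$, $B\in\mathcal B_m$, $|\mu(A\cap T^{-k-n}B)-\mu(A)\mu(B)|\le\psi_k\,\mu(A)\mu(B)$; (3) $\psi_1=\max_{n\in\mathbb N}\psi_n<\infty$. Sets $A$ are taken in $\bigcup_n\mathcal B_n$ with $\mu(A)>0$, and $n_A$ denotes the least integer in $\mathbb N$ with $A\in\mathcal B_{n_A}$. Sweep-out sequence: $\tilde s_A(0):=1$, $\tilde s_A(k):=\mu(A^c\cap T^{-1}A^c\cap\cdots\cap T^{-k+1}A^c)$ for $k\ge1$. Escape rate: $\rho_A:=-\lim_{k\to\infty}\frac{\log\tilde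 s_A(k)}{k}\in[0,+\infty]$ (with $\log 0=-\infty$); in a $\psi$-mixing system this limit exists. For $\epsilon>0$, $\mathcal A_\epsilon$ is the family of all such sets $A$ for which there is an integer $\ell_A\ge1$ with (1) $\psi_{\ell_A}<\epsilon$; (2) $(n_A+\ell_A)\,\mu(A)<\epsilon$; (3) $n_A\cdot\sup_{1\le i\le n_A}\frac{\mu(A\cap T^{-i}A)}{\mu(A)}<\epsilon$. *)

(* Defs.v *)
From HB Require Import structures.
From mathcomp Require Import all_boot all_order all_algebra.
From mathcomp Require Import all_classical all_reals all_analysis.

Set Implicit Arguments.
Unset Strict Implicit.
Unset Printing Implicit Defensive.

Import Order.TTheory GRing.Theory Num.Theory.
Import numFieldNormedType.Exports.

Local Open Scope classical_set_scope.
Local Open Scope ring_scope.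
Local Open Scope ereal_scope.

(* Throughout, sequences indexed by {1, 2, ...} are functions on nat whose
   value at 0 is irrelevant: every index is guarded by (0 < n)%N. *)

Record measure_preserving (d : measure_display) (X : measurableType d)
    (R : realType) (mu : probability X R) (T : X -> X) : Prop := {
  mp_measurable : measurable_fun [set: X] T ;
  mp_preimage : forall A, measurable A -> mu (T @^-1` A) = mu A }.

Definition ergodic (d : measure_display) (X : measurableType d)
    (R : realType) (mu : probability X R) (T : X -> X) : Prop :=
  forall A, measurable A -> T @^-1` A = A -> mu A = 0 \/ mu A = 1.

Record filtration (d : measure_display) (X : measurableType d)
    (T : X -> X) (B : nat -> set (set X)) : Prop := {
  filtration_sigma : forall n, (0 < n)%N -> sigma_algebra [set: X] (B n) ;
  filtration_sub : forall n, (0 < n)%N -> B n `<=` measurable ;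
  filtration_incr : forall n, (0 < n)%N -> B n `<=` B n.+1 ;
  filtration_preimage : forall n A, (0 < n)%N -> B n A ->
    B n.+1 (T @^-1` A) }.

Record psi_mixing (d : measure_display) (X : measurableType d)
    (R : realType) (mu : probability X R) (T : X -> X)
    (B : nat -> set (set X)) (psi : nat -> R) : Prop := {
  psi_ge0 : forall n, (0 < n)%N -> (0 <= psi n)%R ;
  psi_cvg0 : psi n @[n --> \oo] --> (0 : R)%R ;
  psi_mix : forall n m k, (0 < n)%N -> (0 < m)%N -> (0 < k)%N ->
    forall A C, B n A -> B m C ->
    `| mu (A `&` iter (k + n) T @^-1` C) - mu A * mu C |
      <= (psi k)%:E * mu A * mu C ;
  psi_max : forall n, (0 < n)%N -> (psi n <= psi 1)%R }.

(* Such an n is unique, and it exists exactly when A lies in some B_n, n >= 1. *)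
Definition least_index (X : Type) (B : nat -> set (set X)) (A : set X)
    (n : nat) : Prop :=
  [/\ (0 < n)%N, B n A & forall m, (0 < m)%N -> B m A -> (n <= m)%N].

(* At k = 0 the intersection is empty, so that the value is mu setT = 1. *)
Definition sweep_out (d : measure_display) (X : measurableType d)
    (R : realType) (mu : probability X R) (T : X -> X) (A : set X)
    (k : nat) : \bar R :=
  mu (\bigcap_(i < k) (iter i T @^-1` (~` A))).

(* lne 0 = -oo, so that the rate may be +oo. *)
Definition escape_rate (d : measure_display) (X : measurableType d)
    (R : realType) (mu : probability X R) (T : X -> X) (A : set X) : \bar R :=
  - limn (fun k : nat => lne (sweep_out mu T A k) / (k%:R)%:E).

(* B and psi are meant to witness psi_mixing. The existence of nA includes the
   requirement that A belongs to the union of the B_n, n >= 1. *)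
Definition small_set_family (d : measure_display) (X : measurableType d)
    (R : realType) (mu : probability X R) (T : X -> X)
    (B : nat -> set (set X)) (psi : nat -> R) (eps : R) : set (set X) :=
  [set A | 0 < mu A /\
    exists nA l : nat, [/\ least_index B A nA, (0 < l)%N,
      (psi l < eps)%R,
      ((nA + l)%:R)%:E * mu A < eps%:E &
      (nA%:R)%:E *
        ereal_sup [set mu (A `&` iter i T @^-1` A) / mu A
                  | i in [set i : nat | (1 <= i <= nA)%N]] < eps%:E]].

(* Main.v *)
(** Let E_k be the set of points that do not visit A at times 0, ..., k-1, let
    s(k) = mu(E_k), a = mu(A), and let g = n_A - 1 + l be the gap after which
    E_j and E_k decouple, so that g a < eps.

    - Inserting a gap gives s(j+g+k) <= (1+eps) s(j) s(k). By Fekete's lemma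
      the limit L of (log s(k))/k exists, and for every N it satisfies
      (N+g) L <= log((1+eps) s(N)).
    - s(k) - s(k+1) = mu(E_k /\ T^-k A) <= (1+eps) a s(k-g): forget the last
      g steps, then mix. By induction s(k+1) >= (1-t) s(k) with
      t = (1+delta/2) a, hence L >= log(1-t).
    - mu(E_k /\ T^-k A) >= a - sum_(1<=j<=k) mu(A /\ T^-j A). The terms with
      j <= n_A add up to at most eps a by the short-return condition, the
      others are at most (1+psi_1) a^2 by mixing. This bounds s(N) above;
      a block length N with N a small but much larger than eps turns the
      Fekete bound into -L >= (1-delta) a. *)
Require Import Defs.
From HB Require Import structures.
From mathcomp Require Import all_boot all_order all_algebra.
From mathcomp Require Import all_classical all_reals all_analysis.
From mathcomp Require Import ring lra zify.

Set Implicit Arguments.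
Unset Strict Implicit.

Import Order.TTheory GRing.Theory Num.Theory.
Import numFieldNormedType.Exports.
Local Open Scope classical_set_scope.
Local Open Scope ring_scope.

(** * Subadditive sequences and their rates *)

(** The limit is the infimum of the quotients: dividing [k] by an [m] whose quotient is nearly
    minimal leaves an error bounded in [k], which vanishes after division by [k]. *)
Lemma fekete (R : realType) (u : nat -> R) (c : R) :
  (forall j k, u (j + k)%N <= u j + u k) ->
  (forall k, c * k%:R <= u k) ->
  exists2 L : R, (u k / k%:R) @[k --> \oo] --> L &
    forall k, (0 < k)%N -> L <= u k / k%:R.
Proof.
move=> usub ulb.
pose S := [set u k / k%:R | k in [set k : nat | (0 < k)%N]].
have Slb : has_lbound S.
  exists c => _ [k /= k0 <-].
  by rewrite ler_pdivlMr ?ltr0n.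
have S0 : has_inf S by split => //; exists (u 1%N / 1%:R), 1%N.
have Lle k : (0 < k)%N -> inf S <= u k / k%:R.
  by move=> k0; apply: ge_inf => //; exists k.
exists (inf S) => //.
set L := inf S in Lle *.
apply/cvgrPdist_le => e e0.
have e20 : 0 < e / 2 by rewrite divr_gt0.
have [_ [m /= m0 <-] um] := inf_adherent e20 S0.
rewrite -/L ltr_pdivrMr ?ltr0n // in um.
pose b := `|L + e / 2|.
(* [M] covers, uniformly in [k], the term [u 0], the value of [u] at the remainder, and the change
   from the multiple of [m] to [k] in the linear term. *)
pose M := `|u 0%N| + \sum_(r < m) `|u r| + m%:R * b.
have uM k : u k <= k%:R * (L + e / 2) + M.
  have uq q : u (q * m)%N <= q%:R * u m + u 0%N.
    elim: q => [|q IH]; first by rewrite mul0n mul0r add0r.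
    by rewrite mulSn (le_trans (usub _ _)) // -natr1; lra.
  have ur r : (r < m)%N -> u r <= \sum_(r < m) `|u r|.
    move=> rm; rewrite (bigD1 (Ordinal rm)) //=.
    rewrite (le_trans (ler_norm _)) // lerDl.
    by apply: sumr_ge0.
  have -> : u k = u (k %/ m * m + k %% m)%N by rewrite -divn_eq.
  have kE : k%:R = (k %/ m)%:R * m%:R + (k %% m)%:R :> R.
    by rewrite -natrM -natrD -divn_eq.
  have := usub (k %/ m * m)%N (k %% m)%N.
  have := uq (k %/ m)%N; have := ur _ (ltn_pmod k m0).
  have : (k %/ m)%:R * u m <= (k %/ m)%:R * ((L + e / 2) * m%:R).
    by rewrite ler_wpM2l // ltW.
  have : - (m%:R * b) <= (k %% m)%:R * (L + e / 2).
    rewrite lerNl -mulrN (le_trans (ler_norm _)) // normrM normrN normr_nat.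
    by rewrite ler_wpM2r // ler_nat ltnW // ltn_pmod.
  have := ler_norm (u 0%N); rewrite kE /M; lra.
near=> k.
have k0 : (0 < k)%N by near: k; exact: nbhs_infty_gt.
have k0' : 0 < k%:R :> R by rewrite ltr0n.
have := Lle _ k0; have := uM k => h1 h2.
rewrite distrC ger0_norm ?subr_ge0 // lerBlDr ler_pdivrMr //.
have : M / (e / 2) <= k%:R by near: k; exact: nbhs_infty_ger.
rewrite ler_pdivrMr //; lra.
Unshelve. all: by end_near.
Qed.

(* The gap [g] is absorbed by applying Fekete's lemma to
   [k |-> ln ((1 + e) * s (k - g))]. *)
Lemma gapped_submultiplicative_rate (R : realType) (s : nat -> R) (e b : R)
    (g : nat) :
  0 <= e -> s 0%N = 1 -> (forall j k, (j <= k)%N -> s k <= s j) ->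
  0 < b -> (forall k, b ^+ k <= s k) ->
  (forall j k, (0 < j)%N -> (0 < k)%N ->
    s (j + g + k)%N <= (1 + e) * s j * s k) ->
  exists L : R, [/\ ln (s k) / k%:R @[k --> \oo] --> L,
    ln b <= L &
    forall N, (0 < N)%N -> L * (N + g)%:R <= e + ln (s N)].
Proof.
move=> e0 s0 santi b0 sb ssub.
have sgt0 k : 0 < s k by rewrite (lt_le_trans _ (sb k)) // exprn_gt0.
have e1 : 0 < 1 + e by lra.
have s1 k : s k <= 1 by rewrite -s0 santi.
pose u k := ln ((1 + e) * s (k - g)%N).
have uE k : u k = ln (1 + e) + ln (s (k - g)%N) by rewrite /u lnM ?posrE.
have blnk k : ln b * k%:R <= ln (s k).
  by rewrite mulr_natr -lnXn // ler_ln ?posrE ?exprn_gt0.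
have b1 : ln b <= 0.
  by rewrite ln_le0 // -(expr1 b) (le_trans (sb 1%N)).
have lne0 : 0 <= ln (1 + e) by rewrite ln_ge0 // lerDl.
have lne1 : ln (1 + e) <= e by rewrite le_ln1Dx //; lra.
have [||L uL Lle] := @fekete R u (ln b).
- move=> j k; rewrite /u -lnM ?posrE ?mulr_gt0 // ler_ln ?posrE ?mulr_gt0 //.
  rewrite -mulrA ler_pM2l //.
  (* When an index is at most [g], truncated subtraction gives the factor [s 0 = 1], and
     monotonicity of [s] suffices. *)
  have [jg|jg] := leqP j g.
    have -> : (j - g = 0)%N by lia.
    rewrite s0 mul1r.
    have : s (j + k - g)%N <= s (k - g)%N by apply: santi; lia.
    by have := sgt0 (k - g)%N; nra.
  have [kg|kg] := leqP k g.
    have -> : (k - g = 0)%N by lia.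
    rewrite s0 mulr1.
    have : s (j + k - g)%N <= s (j - g)%N by apply: santi; lia.
    by have := sgt0 (j - g)%N; nra.
  have -> : (j + k - g = (j - g) + g + (k - g))%N by lia.
  rewrite (le_trans (ssub _ _ _ _)) ?subn_gt0 //.
  by rewrite (mulrC (s _)) -!mulrA ler_pM2l // mulrC.
- move=> k; rewrite uE.
  have : ln b * k%:R <= ln b * (k - g)%:R.
    by rewrite ler_wnM2l // ler_nat leq_subr.
  have := blnk (k - g)%N; lra.
have sL : ln (s k) / k%:R @[k --> \oo] --> L.
  have inv0 : (k%:R^-1 : R) @[k --> \oo] --> (0 : R).
    rewrite -(cvg_shiftS (fun k : nat => k%:R^-1 : R)).
    exact: cvg_harmonic.
  have ug : u (k + g)%N / (k + g)%:R @[k --> \oo] --> L.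
    by rewrite (cvg_shiftn g (fun k => u k / k%:R)).
  (* Undo the shift by [g] and the additive [ln (1 + e)]: for [k > 0] this expression equals
     [ln (s k) / k]. *)
  have : u (k + g)%N / (k + g)%:R * (1 + g%:R * k%:R^-1) - ln (1 + e) * k%:R^-1
      @[k --> \oo] --> L * (1 + g%:R * 0) - ln (1 + e) * 0.
    apply: cvgB; last exact: cvgMr.
    by apply: cvgM => //; apply: cvgD; [exact: cvg_cst|exact: cvgMr].
  rewrite !mulr0 addr0 subr0 mulr1; apply: cvg_trans.
  apply: near_eq_cvg; near=> k.
  have k0 : (0 < k)%N by near: k; exact: nbhs_infty_gt.
  have k0' : k%:R != 0 :> R by rewrite pnatr_eq0 -lt0n.
  have kg0 : k%:R + g%:R != 0 :> R by rewrite -natrD pnatr_eq0; lia.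
  rewrite uE addnK natrD; field.
  by rewrite k0' kg0.
exists L; split => //.
- rewrite -(cvg_lim _ sL) //; apply: limr_ge.
    by apply/cvg_ex; exists L.
  near=> k.
  have k0 : (0 < k)%N by near: k; exact: nbhs_infty_gt.
  by rewrite ler_pdivlMr ?ltr0n.
- move=> N N0; have NG : (0 < N + g)%N by lia.
  have := Lle _ NG; rewrite ler_pdivlMr ?ltr0n // uE addnK; lra.
Unshelve. all: by end_near.
Qed.

(** * Two-sided bounds on the rate of a real sequence *)

(** The recursion looks back [g] steps. If [s] has so far shrunk by at most [1 - t] per step, then
    [s (k - g)] exceeds [s k] by a factor of at most [(1 - t) ^- g], which the hypothesis on [q]
    absorbs. *)
Lemma sweep_lower_bound (R : realType) (s : nat -> R) (t q : R) (g : nat) :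
  s 0%N = 1 -> (forall k, 0 <= s k) -> 0 <= q -> 0 <= t -> t < 1 -> q <= t * (1 - t) ^+ g ->
  (forall k, s k - s k.+1 <= q * s (k - g)%N) ->
  forall k, (1 - t) ^+ k <= s k.
Proof.
move=> s0 sge0 q0 t0 t1 qt srec.
have t10 : 0 < 1 - t by lra.
(* Comparing [s (k - g)] with [s k] requires the bound from every earlier index [j], not only from
   0. *)
suff H k : (1 - t) ^+ k <= s k /\
    forall j, (j <= k)%N -> (1 - t) ^+ (k - j) * s j <= s k.
  by move=> k; have [] := H k.
elim: k => [|k [IHs IH]].
  split; first by rewrite expr0 s0.
  by move=> j; rewrite leqn0 => /eqP ->; rewrite subnn expr0 mul1r.
have step : (1 - t) * s k <= s k.+1.
  have sg := IH (k - g)%N (leq_subr _ _).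
  have : (1 - t) ^+ g * s (k - g)%N <= s k.
    apply: le_trans sg; rewrite ler_wpM2r // ler_wiXn2l //; [lra|lra|lia].
  move=> /(ler_wpM2l t0); have := ler_wpM2r (sge0 (k - g)%N) qt.
  have := srec k; lra.
split.
  by rewrite exprS (le_trans _ step) // ler_pM2l.
move=> j; rewrite leq_eqVlt => /orP[/eqP ->|jk].
  by rewrite subnn expr0 mul1r.
by rewrite subSn // exprS -mulrA (le_trans _ step) // ler_pM2l // IH.
Qed.

(** The constant 36 serves twice: [e <= delta / 36], and [12 * e <= eta * delta] for the block size
    [eta = delta / (3 * C)] chosen below. *)
Lemma rate_bounds (R : realType) (s : nat -> R) (a e C delta : R) (g : nat) :
  0 < delta < 1 -> 1 <= C -> 0 < a -> 0 < e ->
  36 * C * e <= delta ^+ 2 -> g.+1%:R * a <= e ->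
  s 0%N = 1 -> (forall k, 0 <= s k) -> (forall j k, (j <= k)%N -> s k <= s j) ->
  (forall j k, (0 < j)%N -> (0 < k)%N ->
    s (j + g + k)%N <= (1 + e) * s j * s k) ->
  (forall k, s k - s k.+1 <= (1 + e) * a * s (k - g)%N) ->
  (forall k, a - e * a - k%:R * C * a ^+ 2 <= s k - s k.+1) ->
  exists2 L : R, (forall k, 0 < s k) /\ ln (s k) / k%:R @[k --> \oo] --> L &
    `|1 - - L / a| <= delta.
Proof.
move=> /andP[d0 d1] C1 a0 e0 eC ga s0 sge0 santi ssub srec sret.
have ae : a <= e by move: ga; rewrite -natr1; have : 0 <= g%:R * a by [rewrite mulr_ge0 // ltW]; nra.
have gae : g%:R * a <= e by move: ga; rewrite -natr1; nra.
have ed : 36 * e <= delta by nra.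
(* The slack [delta / 2] pays for the factor [1 + e] and for the loss
   [(1 - t) ^+ g >= 1 - g * t]. *)
pose t := (1 + delta / 2) * a.
have t0 : 0 < t by rewrite mulr_gt0 //; lra.
have t1 : t <= 1 / 12 by rewrite /t; nra.
have tg : g%:R * t <= (1 + delta / 2) * e by rewrite /t; nra.
have bernoulli : 1 - g%:R * t <= (1 - t) ^+ g.
  elim: {ga gae tg srec ssub} g => [|n IH]; first by rewrite mul0r subr0 expr0.
  have n0 : 0 <= n%:R :> R by [].
  rewrite exprS -natr1.
  have : (1 - t) * (1 - n%:R * t) <= (1 - t) * (1 - t) ^+ n.
    by rewrite ler_pM2l //; lra.
  have : 0 <= n%:R * (t * t) by rewrite mulr_ge0 // mulr_ge0 // ltW.
  nra.
have qt : (1 + e) * a <= t * (1 - t) ^+ g.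
  apply: (@le_trans _ _ (t * (1 - (1 + delta / 2) * e))); last first.
    by rewrite ler_pM2l //; lra.
  rewrite /t mulrAC ler_pM2r //; nra.
have slb : forall k, (1 - t) ^+ k <= s k.
  by apply: (@sweep_lower_bound _ s t ((1 + e) * a) g) => //; nra.
have b0 : 0 < 1 - t by lra.
have [L [sL Lge Lle]] :=
  @gapped_submultiplicative_rate R s e _ g (ltW e0) s0 santi b0 slb ssub.
exists L; first by split => // k; rewrite (lt_le_trans _ (slb k)) // exprn_gt0.
rewrite ler_distl.
have upper : - L <= (1 + delta) * a.
  have lnt : - ln (1 - t) <= t / (1 - t).
    rewrite -lnV ?posrE //.
    have invE : (1 - t)^-1 = 1 + t / (1 - t) by field; lra.
    by rewrite [in X in ln X]invE le_ln1Dx // (@lt_le_trans _ _ 0) ?divr_ge0 ?ltW.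
  have : t / (1 - t) <= (1 + delta) * a.
    rewrite ler_pdivrMr // /t [X in _ <= X]mulrAC ler_pM2r //; nra.
  lra.
have lower : (1 - delta) * a <= - L.
  (* Blocks of measure [N * a ~ eta]: [eta] must dominate the gap and mixing
     errors, of order [e], while [C * eta] controls the long returns. *)
  pose eta := delta / (3 * C).
  have C0 : 0 < C by lra.
  have etaC : eta * (3 * C) = delta by rewrite /eta; field; lra.
  have eta0 : 0 < eta by rewrite divr_gt0 // mulr_gt0.
  have eeta : 12 * e <= eta * delta by nra.
  (* Rounding down costs less than [a <= e], so [N * a] stays above [eta / 2]. *)
  pose N := Num.truncn (eta / a).
  have /andP[N1 N2] := @Num.Theory.truncn_itv _ (eta / a) (divr_ge0 (ltW eta0) (ltW a0)).
  rewrite -/N ler_pdivlMr // in N1; rewrite -/N ltr_pdivrMr // -natr1 in N2.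
  set x := N%:R * a in N1.
  have x2 : eta / 2 <= x by rewrite /x; nra.
  have x0 : 0 < x by lra.
  have N0 : (0 < N)%N.
    by rewrite -(ltr_nat R); rewrite -(pmulr_lgt0 _ a0).
  (* Sum the first [n] decrements, each bounded below by the worst case [k = n]. *)
  have sN n : s n <= 1 - n%:R * (a - e * a - n%:R * C * a ^+ 2).
    elim: n => [|n IH]; first by rewrite mul0r subr0 s0.
    have := sret n; rewrite -natr1.
    have : 0 <= n%:R * (C * a ^+ 2) by rewrite mulr_ge0 // mulr_ge0 ?exprn_ge0 ?ltW.
    have : 0 <= C * a ^+ 2 by rewrite mulr_ge0 ?exprn_ge0 ?ltW.
    lra.
  have lnN : ln (s N) <= s N - 1.
    have sN0 : 0 < s N by rewrite (lt_le_trans _ (slb N)) // exprn_gt0.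
    have := @le_ln1Dx _ (s N - 1); have -> : 1 + (s N - 1) = s N by lra.
    by apply; lra.
  have key := Lle _ N0.
  have sNx := sN N.
  have sNx' : s N <= 1 - x * (1 - e - C * x) by rewrite /x; lra.
  have X : x * (1 - e - C * x) - e <= - L * (N + g)%:R by lra.
  (* Relative to [x], the loss is at most [delta / 3] from [C * x], [delta / 36] from the factor
     [e], and [delta / 6] from each of the two additive [e]. *)
  have D : (1 - delta) * (x + e) <= x * (1 - e - C * x) - e.
    have : C * x <= delta / 3 by nra.
    nra.
  have NG : (N + g)%:R * a <= x + e by rewrite natrD mulrDl /x; lra.
  have NG0 : 0 < (N + g)%:R :> R by rewrite ltr0n addn_gt0 N0.
  rewrite -(ler_pM2r NG0) (le_trans _ X) // (le_trans _ D) //.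
  by rewrite -mulrA (mulrC a) ler_wpM2l //; lra.
have [h1 h2] : 1 - delta <= - L / a /\ - L / a <= 1 + delta.
  by split; rewrite ?ler_pdivlMr ?ler_pdivrMr.
apply/andP; split; lra.
Qed.

(** * Sweep-out sets: measurability, invariance, filtration level *)

Lemma sigma_algebraI (X : Type) (G : set (set X)) (E F : set X) :
  sigma_algebra [set: X] G -> G E -> G F -> G (E `&` F).
Proof. by move=> /sigma_algebraP [] // _ _ _ h; exact: h. Qed.

Lemma iter_preimage_add (X : Type) (T : X -> X) (j k : nat) (C : set X) :
  iter (j + k) T @^-1` C = iter k T @^-1` (iter j T @^-1` C).
Proof. by apply/seteqP; split => x /=; rewrite iterD. Qed.

Lemma sweep_succ (X : Type) (T : X -> X) (A : set X) (k : nat) :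
  \bigcap_(i < k.+1) (iter i T @^-1` (~` A)) =
  \bigcap_(i < k) (iter i T @^-1` (~` A)) `&` iter k T @^-1` (~` A).
Proof. by rewrite !bigcap_mkord big_ord_recr. Qed.

Lemma measurable_iter_preimage (d : measure_display) (X : measurableType d)
    (R : realType) (mu : probability X R) (T : X -> X) (k : nat) (C : set X) :
  measure_preserving mu T -> measurable C -> measurable (iter k T @^-1` C).
Proof.
move=> [mT _]; elim: k C => [|k IH] C mC //.
apply: (IH (T @^-1` C)).
by rewrite -[_ @^-1` _]setTI; apply: mT.
Qed.

Lemma measure_iter_preimage (d : measure_display) (X : measurableType d)
    (R : realType) (mu : probability X R) (T : X -> X) (k : nat) (C : set X) :
  measure_preserving mu T -> measurable C -> mu (iter k T @^-1` C) = mu C.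
Proof.
move=> hT; have [mT muT] := hT; elim: k C => [|k IH] C mC //.
rewrite -(muT C mC); apply: (IH (T @^-1` C)).
by rewrite -[_ @^-1` _]setTI; apply: mT.
Qed.

Lemma measurable_sweep (d : measure_display) (X : measurableType d)
    (R : realType) (mu : probability X R) (T : X -> X) (A : set X) (k : nat) :
  measure_preserving mu T -> measurable A ->
  measurable (\bigcap_(i < k) (iter i T @^-1` (~` A))).
Proof.
move=> hT mA; elim: k => [|k IH]; first by rewrite II0 bigcap_set0.
rewrite sweep_succ; apply: measurableI => //.
by apply: (measurable_iter_preimage _ hT); exact: measurableC.
Qed.

(** Each preimage raises the level by one, and the last of the [k.+1] conditions is at time [k].
    This off-by-one makes the gap [n.-1 + l] rather than [n + l]. *)
Lemma sweep_filtration (d : measure_display) (X : measurableType d)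
    (T : X -> X) (B : nat -> set (set X)) (A : set X) (n k : nat) :
  filtration T B -> (0 < n)%N -> B n A ->
  B (n + k)%N (\bigcap_(i < k.+1) (iter i T @^-1` (~` A))).
Proof.
move=> [sB _ iB pB] n0 BA.
have BC j : B (n + j)%N (iter j T @^-1` (~` A)).
  elim: j => [|j IH].
    by rewrite addn0 -setTD; case: (sB _ n0) => _ + _; apply.
  have -> : iter j.+1 T @^-1` (~` A) = T @^-1` (iter j T @^-1` (~` A)).
    by rewrite -[in LHS]addn1 iter_preimage_add.
  by rewrite addnS; apply: pB => //; rewrite addn_gt0 n0.
elim: k => [|k IH].
  by rewrite sweep_succ II0 bigcap_set0 setTI; exact: BC.
rewrite sweep_succ; apply: sigma_algebraI; last exact: BC.
  by apply: sB; rewrite addn_gt0 n0.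
by rewrite addnS; apply: iB => //; rewrite addn_gt0 n0.
Qed.

Lemma le_fine_measure (d : measure_display) (X : measurableType d)
    (R : realType) (mu : probability X R) (E F : set X) :
  measurable E -> measurable F -> E `<=` F -> fine (mu E) <= fine (mu F).
Proof.
move=> mE mF EF; apply: fine_le; rewrite ?fin_num_measure //.
by apply: le_measure; rewrite ?inE.
Qed.

(** * Mixing estimates for the sweep-out sequence *)

Lemma psi_mixing_le (d : measure_display) (X : measurableType d)
    (R : realType) (mu : probability X R) (T : X -> X)
    (B : nat -> set (set X)) (psi : nat -> R) (n m k : nat) (E F : set X) :
  filtration T B -> measure_preserving mu T -> psi_mixing mu T B psi ->
  (0 < n)%N -> (0 < m)%N -> (0 < k)%N -> B n E -> B m F ->
  fine (mu (E `&` iter (k + n) T @^-1` F)) <=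
    (1 + psi k) * (fine (mu E) * fine (mu F)).
Proof.
move=> [_ mB _ _] hT [_ _ mix _] n0 m0 k0 BE BF.
have mE := mB _ n0 _ BE; have mF := mB _ m0 _ BF.
have := mix _ _ _ n0 m0 k0 _ _ BE BF.
have mI : measurable (E `&` iter (k + n) T @^-1` F).
  by apply: measurableI => //; exact: (measurable_iter_preimage _ hT).
rewrite -(fineK (fin_num_measure mu _ mE)) -(fineK (fin_num_measure mu _ mF)).
rewrite -(fineK (fin_num_measure mu _ mI)).
rewrite -!EFinM -EFinB /= lee_fin => /(le_trans (ler_norm _)).
lra.
Qed.

Lemma sweep_decrement (d : measure_display) (X : measurableType d)
    (R : realType) (mu : probability X R) (T : X -> X) (A : set X) (k : nat) :
  measure_preserving mu T -> measurable A ->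
  fine (sweep_out mu T A k) - fine (sweep_out mu T A k.+1) =
  fine (mu (\bigcap_(i < k) (iter i T @^-1` (~` A)) `&` iter k T @^-1` A)).
Proof.
move=> hT mA; rewrite /sweep_out sweep_succ.
set E := \bigcap_(i < k) _; set F := _ @^-1` A.
have mE : measurable E by exact: (measurable_sweep _ hT).
have mF : measurable F by exact: (measurable_iter_preimage _ hT).
have -> : iter k T @^-1` (~` A) = ~` F by [].
rewrite -setDE.
have := @measureDI _ _ _ mu E F mE mF => ->.
rewrite fineD ?fin_num_measure //; [|exact: measurableD|exact: measurableI].
by lra.
Qed.

(** Drop the conditions in the gap. The first block has level [n + j], and the second starts at time
    [l + (n + j)], so mixing applies with [psi l]. *)
Lemma sweep_submult (d : measure_display) (X : measurableType d)
    (R : realType) (mu : probability X R) (T : X -> X)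
    (B : nat -> set (set X)) (psi : nat -> R) (A : set X) (n l j k : nat) :
  filtration T B -> measure_preserving mu T -> psi_mixing mu T B psi ->
  (0 < n)%N -> B n A -> (0 < l)%N ->
  fine (sweep_out mu T A (j.+1 + (n.-1 + l) + k.+1)) <=
    (1 + psi l) *
      (fine (sweep_out mu T A j.+1) * fine (sweep_out mu T A k.+1)).
Proof.
move=> hB hT hpsi n0 BA l0.
have mA : measurable A by exact: (filtration_sub hB n0).
apply: le_trans (psi_mixing_le hB hT hpsi _ _ l0
  (sweep_filtration j hB n0 BA) (sweep_filtration k hB n0 BA)); last 2 first.
- by rewrite addn_gt0 n0.
- by rewrite addn_gt0 n0.
apply: le_fine_measure.
- exact: (measurable_sweep _ hT).
- apply: measurableI; first exact: (measurable_sweep _ hT).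
  apply: (measurable_iter_preimage _ hT).
  exact: (measurable_sweep _ hT).
move=> x h; split => i /= ik.
  by apply: h => /=; lia.
rewrite /preimage /= -iterD; apply: (h (i + (l + (n + j)))%N) => /=; lia.
Qed.

Lemma sweep_decrement_le (d : measure_display) (X : measurableType d)
    (R : realType) (mu : probability X R) (T : X -> X)
    (B : nat -> set (set X)) (psi : nat -> R) (A : set X) (n l k : nat) :
  filtration T B -> measure_preserving mu T -> psi_mixing mu T B psi ->
  (0 < n)%N -> B n A -> (0 < l)%N ->
  fine (sweep_out mu T A k) - fine (sweep_out mu T A k.+1) <=
    (1 + psi l) * fine (mu A) * fine (sweep_out mu T A (k - (n.-1 + l))).
Proof.
move=> hB hT hpsi n0 BA l0.
have mA : measurable A by exact: (filtration_sub hB n0).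
rewrite sweep_decrement //.
(* For [k] within the gap the truncated index is 0, and [mu A] alone bounds the decrement. *)
have [kg|kg] := leqP k (n.-1 + l).
  have -> : (k - (n.-1 + l) = 0)%N by lia.
  rewrite /sweep_out II0 bigcap_set0 probability_setT mulr1.
  have : fine (mu (\bigcap_(i < k) (iter i T @^-1` (~` A)) `&`
      iter k T @^-1` A)) <= fine (mu A).
    rewrite -[in leRHS](measure_iter_preimage k hT mA).
    have mF := measurable_iter_preimage k hT mA.
    apply: le_fine_measure => //.
    by apply: measurableI => //; exact: (measurable_sweep _ hT).
  have := psi_ge0 hpsi l0; have : 0 <= fine (mu A) by rewrite fine_ge0.
  nra.
pose j := (k - (n.-1 + l)).-1.
have jE : (k - (n.-1 + l) = j.+1)%N by rewrite /j; lia.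
rewrite jE -mulrA (mulrC (fine (mu A))).
apply: le_trans (psi_mixing_le hB hT hpsi _ n0 l0
  (sweep_filtration j hB n0 BA) BA); last by rewrite addn_gt0 n0.
have -> : (l + (n + j) = k)%N by lia.
have mF := measurable_iter_preimage k hT mA.
apply: le_fine_measure.
- by apply: measurableI => //; exact: (measurable_sweep _ hT).
- by apply: measurableI => //; exact: (measurable_sweep _ hT).
by apply: setSI => x h i /= ij; apply: h => /=; lia.
Qed.

(** Impose avoidance one time [m] at a time on the points in [A] at time [k]. Those removed visit
    [A] at [m] and again [k - m] steps later, so invariance bounds the loss by a return measure. *)
Lemma sweep_decrement_ge (d : measure_display) (X : measurableType d)
    (R : realType) (mu : probability X R) (T : X -> X) (A : set X) (k : nat) :
  measure_preserving mu T -> measurable A ->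
  fine (mu A) - \sum_(j < k) fine (mu (A `&` iter j.+1 T @^-1` A)) <=
  fine (sweep_out mu T A k) - fine (sweep_out mu T A k.+1).
Proof.
move=> hT mA; rewrite sweep_decrement //.
have mI j C : measurable C -> measurable (iter j T @^-1` C).
  exact: (measurable_iter_preimage _ hT).
have mS j : measurable (\bigcap_(i < j) (iter i T @^-1` (~` A))).
  exact: (measurable_sweep _ hT).
suff H m : (m <= k)%N -> fine (mu A) <=
    fine (mu (\bigcap_(i < m) (iter i T @^-1` (~` A)) `&` iter k T @^-1` A)) +
    \sum_(i < m) fine (mu (A `&` iter (k - i) T @^-1` A)).
  have := H k (leqnn k).
  have -> : \sum_(i < k) fine (mu (A `&` iter (k - i) T @^-1` A)) =
      \sum_(j < k) fine (mu (A `&` iter j.+1 T @^-1` A)).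
    rewrite (reindex_inj rev_ord_inj) /=; apply: eq_bigr => i _.
    by have -> : (k - (k - i.+1) = i.+1)%N by have := ltn_ord i; lia.
  lra.
elim: m => [|m IH] mk.
  by rewrite II0 bigcap_set0 setTI big_ord0 addr0 (measure_iter_preimage k hT mA).
rewrite (le_trans (IH (ltnW mk))) // big_ord_recr /= addrA [leRHS]addrAC lerD2r.
rewrite sweep_succ; set E := \bigcap_(i < m) _; set F := iter k T @^-1` A.
set G := iter m T @^-1` A.
have -> : iter m T @^-1` (~` A) = ~` G by [].
have mG : measurable G by exact: mI.
have mF : measurable F by exact: mI.
have mEF : measurable (E `&` F) by apply: measurableI => //; exact: mS.
have := @measureDI _ _ _ mu _ G mEF mG => ->.
rewrite fineD ?fin_num_measure //; [|exact: measurableD|exact: measurableI].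
have -> : (E `&` F) `\` G = E `&` ~` G `&` F by rewrite setDE -setIA (setIC F) setIA.
rewrite lerD2l.
have mAA : measurable (A `&` iter (k - m) T @^-1` A).
  by apply: measurableI => //; exact: mI.
rewrite -[in leRHS](measure_iter_preimage m hT mAA).
apply: le_fine_measure; [exact: measurableI|exact: mI|].
move=> x [[_ Fx] Gx]; split => //.
by rewrite /preimage /= -iterD subnK // ltnW.
Qed.

(** * From short and long returns to the rate of a small set *)

Lemma return_sum_le (R : realType) (r : nat -> R) (a e C : R) (n k : nat) :
  (0 < n)%N -> 0 <= e -> 0 <= a -> 0 <= C ->
  (forall j, (j < n)%N -> n%:R * r j <= e * a) ->
  (forall j, (n <= j)%N -> r j <= C * a ^+ 2) ->
  \sum_(j < k) r j <= e * a + k%:R * C * a ^+ 2.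
Proof.
move=> n0 e0 a0 C0 rshort rlong.
have n0' : 0 < n%:R :> R by rewrite ltr0n.
have Ca : 0 <= C * a ^+ 2 by rewrite mulr_ge0 // exprn_ge0.
have c0 : 0 <= e * a / n%:R by rewrite divr_ge0 ?mulr_ge0.
(* At most [minn k n] of the terms are short returns, each at most [e * a / n]. *)
have H : \sum_(j < k) r j <=
    (minn k n)%:R * (e * a / n%:R) + k%:R * (C * a ^+ 2).
  elim: k => [|k IH]; first by rewrite big_ord0 min0n !mul0r addr0.
  rewrite big_ord_recr /= -(natr1 k).
  have [kn|nk] := ltnP k n.
    have := rshort _ kn; rewrite mulrC -ler_pdivlMr // => rk.
    move: IH; rewrite (minn_idPl kn) (minn_idPl (ltnW kn)) -natr1; lra.
  have := rlong _ nk.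
  by move: IH; rewrite (minn_idPr nk) (minn_idPr (leqW nk)); lra.
have : (minn k n)%:R * (e * a / n%:R) <= n%:R * (e * a / n%:R).
  by rewrite ler_wpM2r // ler_nat geq_minr.
rewrite [X in _ <= X]mulrC divfK ?gt_eqF //; lra.
Qed.

Lemma small_set_rate (d : measure_display) (X : measurableType d)
    (R : realType) (mu : probability X R) (T : X -> X)
    (B : nat -> set (set X)) (psi : nat -> R) (A : set X) (e delta : R) :
  filtration T B -> measure_preserving mu T -> psi_mixing mu T B psi ->
  0 < delta < 1 -> 36 * (1 + psi 1%N) * e <= delta ^+ 2 ->
  small_set_family mu T B psi e A ->
  exists2 r : R, (escape_rate mu T A / mu A)%E = r%:E & `|1 - r| <= delta.
Proof.
move=> hB hT hpsi d01 eC [A0 [n [l [[n0 BA _] l0 psie gA]]]] ret.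
have mA : measurable A by exact: (filtration_sub hB n0).
have aE : mu A = (fine (mu A))%:E by rewrite fineK ?fin_num_measure.
have a0 : 0 < fine (mu A) by rewrite -lte_fin -aE.
have psil0 := psi_ge0 hpsi l0; have psi10 := psi_ge0 hpsi (ltn0Sn 0).
have e0 : 0 < e by exact: le_lt_trans psie.
pose s k := fine (sweep_out mu T A k).
have sE k : sweep_out mu T A k = (s k)%:E.
  by rewrite /s fineK // fin_num_measure //; exact: (measurable_sweep _ hT).
have sge0 k : 0 <= s k by rewrite /s fine_ge0.
have santi j k : (j <= k)%N -> s k <= s j.
  move=> jk; apply: le_fine_measure; [exact: (measurable_sweep _ hT)..|].
  by move=> x h i /= ij; apply: h => /=; exact: leq_trans jk.
have s0 : s 0%N = 1 by rewrite /s /sweep_out II0 bigcap_set0 probability_setT.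
(* Since [n > 0], the gap plus one is exactly [n + l]. *)
have gA' : (n.-1 + l).+1%:R * fine (mu A) <= e.
  move: gA; rewrite aE -EFinM lte_fin -addSn prednK // => /ltW; exact.
have rshort j : (j < n)%N ->
    n%:R * fine (mu (A `&` iter j.+1 T @^-1` A)) <= e * fine (mu A).
  move=> jn; set r := mu _.
  have mr : measurable (A `&` iter j.+1 T @^-1` A).
    by apply: measurableI => //; exact: (measurable_iter_preimage _ hT).
  have rE : r = (fine r)%:E by rewrite fineK // fin_num_measure.
  have sup : (r / mu A <= ereal_sup [set (mu (A `&` iter i T @^-1` A) / mu A)%E
      | i in [set i : nat | (1 <= i <= n)%N]])%E.
    by apply: ereal_sup_ubound; exists j.+1 => //=; rewrite jn.
  have n0e : (0 <= (n%:R : R)%:E)%E by rewrite lee_fin.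
  have := le_lt_trans (lee_wpmul2l n0e sup) ret.
  rewrite rE aE inver gt_eqF // -!EFinM lte_fin mulrA ltr_pdivrMr //.
  exact: ltW.
have rlong j : (n <= j)%N ->
    fine (mu (A `&` iter j.+1 T @^-1` A)) <= (1 + psi 1%N) * fine (mu A) ^+ 2.
  (* A return time above [n] leaves a mixing gap of at least 1, whose coefficient is at most
     [psi 1]. *)
  move=> nj; have k0 : (0 < j.+1 - n)%N by rewrite subn_gt0 ltnS.
  have -> : (j.+1 = (j.+1 - n) + n)%N by rewrite subnK // leqW.
  rewrite (le_trans (psi_mixing_le hB hT hpsi n0 n0 k0 BA BA)) //.
  rewrite -expr2 ler_wpM2r ?exprn_ge0 ?(ltW a0) // lerD2l.
  exact: (psi_max hpsi).
have [||||L [sgt0 sL] Ld] := @rate_bounds R s (fine (mu A)) e (1 + psi 1%N) delta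
    (n.-1 + l) d01 _ a0 e0 eC gA' s0 sge0 santi.
- lra.
- move=> [//|j] [//|k] _ _.
  have := @sweep_submult _ _ _ mu T B psi A n l j k hB hT hpsi n0 BA l0.
  move=> /le_trans; apply; rewrite -mulrA.
  by apply: ler_wpM2r; [rewrite mulr_ge0 ?fine_ge0|lra].
- move=> k.
  have := @sweep_decrement_le _ _ _ mu T B psi A n l k hB hT hpsi n0 BA l0.
  move=> /le_trans; apply; apply: ler_wpM2r; first by rewrite fine_ge0.
  by apply: ler_wpM2r; [exact: ltW|lra].
- move=> k; have := @sweep_decrement_ge _ _ _ mu T A k hT mA.
  move=> /(le_trans _); apply.
  have C0 : 0 <= 1 + psi 1%N by lra.
  have := @return_sum_le R (fun j => fine (mu (A `&` iter j.+1 T @^-1` A))) _ e _ n k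
    n0 (ltW e0) (ltW a0) C0 rshort rlong.
  lra.
exists (- L / fine (mu A)) => //.
have -> : escape_rate mu T A = (- L)%:E.
  rewrite /escape_rate EFinN; congr (- _)%E.
  apply: cvg_lim => //.
  have : (ln (s k) / k%:R)%:E @[k --> \oo] --> L%:E by apply: cvg_EFin => //; near=> k.
  apply: cvg_trans; apply: near_eq_cvg; near=> k.
  have k0 : (0 < k)%N by near: k; exact: nbhs_infty_gt.
  by rewrite sE lne_EFin // inver pnatr_eq0 gt_eqF // -EFinM.
by rewrite aE inver gt_eqF // -EFinM.
Unshelve. all: by end_near.
Qed.

Unset Implicit Arguments.
Set Strict Implicit.
Local Open Scope ereal_scope.

Theorem theorem3 (d : measure_display) (X : measurableType d) (R : realType)
    (mu : probability X R) (T : X -> X) (B : nat -> set (set X))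
    (psi : nat -> R) (A : nat -> set X)
    (hT : measure_preserving mu T)
    (herg : ergodic mu T)
    (hB : filtration T B)
    (hpsi : psi_mixing mu T B psi)
    (hA : forall n : nat, (0 < n)%N ->
      small_set_family mu T B psi (n%:R^-1)%R (A n)) :
  (escape_rate mu T (A n) / mu (A n)) @[n --> \oo] --> (1 : \bar R).
Proof.
have near_one (delta : R) : (0 < delta < 1)%R ->
    \forall n \near \oo, exists2 r : R,
      escape_rate mu T (A n) / mu (A n) = r%:E & (`|1 - r| <= delta)%R.
  move=> d01; have /andP[d0 _] := d01.
  near=> n.
  have n0 : (0 < n)%N by near: n; exact: nbhs_infty_gt.
  apply: (small_set_rate hB hT hpsi d01 _ (hA _ n0)).
  (* This threshold on [n] is the smallness condition of [small_set_rate] at [e = 1 / n]. *)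
  have : (36 * (1 + psi 1%N) / delta ^+ 2 <= n%:R)%R.
    by near: n; exact: nbhs_infty_ger.
  rewrite ler_pdivrMr ?exprn_gt0 // => h.
  by rewrite ler_pdivrMr ?ltr0n // [leRHS]mulrC.
apply: cvg_EFin.
  have : (0 < (2^-1 : R) < 1)%R by lra.
  move=> /near_one; apply: filterS => n [r -> _] //.
apply/cvgrPdist_le => e e0.
(* Capping at 1/2 keeps the tolerance below 1, as [near_one] demands. *)
have : (0 < Num.min e 2^-1 < 1)%R by rewrite lt_min gt_min e0 /=; lra.
move=> /near_one; apply: filterS => n [r rE].
by rewrite le_min => /andP[h _]; rewrite /= rE.
Unshelve. all: by end_near.
Qed.
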